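(* Let $\mathbb{K}$ be a field of characteristic zero and let $\mathcal{W}_2$ be the terminal algebra of all $2$-dimensional commutative algebras over $\mathbb{K}$. Every local $\frac12$-derivation of $\mathcal{W}_2$ is a $\frac12$-derivation of $\mathcal{W}_2$.
   Context: Algebras are vector spaces over $\mathbb{K}$ with a bilinear multiplication; they need not be associative, commutative or unital. The algebra $\mathcal{W}_2$ (Kantor's algebra of all bilinear commutative operations on a $2$-dimensional space) is the $6$-dimensional algebra over $\mathbb{K}$ with basis $\xi_1,\dots,\xi_6$ and the following multiplication (left factor first; all products of basis elements not listed are $0$): $\xi_1\xi_1=-\xi_1$, $\xi_1\xi_3=\xi_3$, $\xi_1\xi_4=-2\xi_4$, $\xi_1\xi_5=-\xi_5$; $\xi_2\xi_1=-\xi_2$, $\xi_2\xi_2=-2\xi_3$, $\xi_2\xi_4=\xi_1-\xi_5$, $\xi_2\xi_5=\xi_2-2\xi_6$, $\xi_2\xi_6=\xi_3$; $\xi_4\xi_1=\xi_4$, $\xi_4\xi_2=\xi_5-2\xi_1$, $\xi_4\xi_3=-\xi_2+\xi_6$, $\xi_4\xi_5=-2\xi_4$, $\xi_4\xi_6=-\xi_5$; $\xi_5\xi_2=-\xi_2$, $\xi_5\xi_3=-2\xi_3$, $\xi_5\xi_4=\xi_4$, $\xi_5\xi_6=-\xi_6$. A linear map $d:\mathcal{A}\to\mathcal{A}$ on an algebra $\mathcal{A}$ is a $\frac12$-derivation if $d(xy)=\frac12\big(d(x)y+x\,d(y)\big)$ for all $x,y\in\mathcal{A}$. A linear map $D:\mathcal{A}\to\mathcal{A}$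 is a local $\frac12$-derivation if for every $x\in\mathcal{A}$ there exists a $\frac12$-derivation $d_x$ of $\mathcal{A}$ such that $D(x)=d_x(x)$. *)

(* Defs.v *)
From HB Require Import structures.
From mathcomp Require Import all_boot all_order all_algebra.

Set Implicit Arguments.
Unset Strict Implicit.
Unset Printing Implicit Defensive.

Import GRing.Theory.
Local Open Scope ring_scope.

(* An algebra here is a vector space A with a bilinear product mul, not       *)
(* assumed associative, commutative or unital; hence mul is a parameter       *)
(* rather than the product of an algType.                                     *)

Definition half_derivation (K : fieldType) (A : lmodType K)
    (mul : A -> A -> A) (d : {linear A -> A}) : Prop :=
  forall x y : A, d (mul x y) = (2%:R : K)^-1 *: (mul (d x) y + mul x (d y)).

Definition local_half_derivation (K : fieldType) (A : lmodType K)
    (mul : A -> A -> A) (D : {linear A -> A}) : Prop :=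
  forall x : A, exists2 d : {linear A -> A}, half_derivation mul d & D x = d x.

(* xi K k is the k-th basis vector, 1 <= k <= 6, i.e. the row vector whose    *)
(* entry of (0-based) index k - 1 is 1; k outside this range is never used.   *)
Definition xi (K : fieldType) (k : nat) : 'rV[K]_6 := delta_mx 0 (inord k.-1).

Definition W2_table (K : fieldType) (i j : nat) : 'rV[K]_6 :=
  match i, j with
  | 1%N, 1%N => - xi K 1
  | 1%N, 3%N => xi K 3
  | 1%N, 4%N => - (2%:R *: xi K 4)
  | 1%N, 5%N => - xi K 5
  | 2%N, 1%N => - xi K 2
  | 2%N, 2%N => - (2%:R *: xi K 3)
  | 2%N, 4%N => xi K 1 - xi K 5
  | 2%N, 5%N => xi K 2 - 2%:R *: xi K 6
  | 2%N, 6%N => xi K 3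
  | 4%N, 1%N => xi K 4
  | 4%N, 2%N => xi K 5 - 2%:R *: xi K 1
  | 4%N, 3%N => - xi K 2 + xi K 6
  | 4%N, 5%N => - (2%:R *: xi K 4)
  | 4%N, 6%N => - xi K 5
  | 5%N, 2%N => - xi K 2
  | 5%N, 3%N => - (2%:R *: xi K 3)
  | 5%N, 4%N => xi K 4
  | 5%N, 6%N => - xi K 6
  | _, _ => 0
  end.

Definition W2_mul (K : fieldType) (x y : 'rV[K]_6) : 'rV[K]_6 :=
  \sum_(i < 6) \sum_(j < 6) (x 0 i * y 0 j) *: W2_table K i.+1 j.+1.

Lemma W2_mul_linearl (K : fieldType) (y : 'rV[K]_6) :
  linear (fun x => W2_mul x y).
Proof.
move=> a u v; rewrite /W2_mul scaler_sumr -big_split; apply: eq_bigr => i _.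
rewrite /= scaler_sumr -big_split; apply: eq_bigr => j _ /=.
by rewrite !mxE mulrDl scalerDl -mulrA scalerA.
Qed.

Lemma W2_mul_linearr (K : fieldType) (x : 'rV[K]_6) : linear (W2_mul x).
Proof.
move=> a u v; rewrite /W2_mul scaler_sumr -big_split; apply: eq_bigr => i _.
rewrite /= scaler_sumr -big_split; apply: eq_bigr => j _ /=.
by rewrite !mxE mulrDr scalerDl mulrCA scalerA.
Qed.

Lemma W2_mul_xi (K : fieldType) (i j : 'I_6) :
  W2_mul (xi K i.+1) (xi K j.+1) = W2_table K i.+1 j.+1.
Proof.
rewrite /W2_mul (bigD1 i) //= (bigD1 j) //= !mxE !inord_val !eqxx mulr1 scale1r.
rewrite [X in _ + X + _]big1 => [|k /negPf kj]; last first.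
  by rewrite !mxE inord_val kj mulr0 scale0r.
rewrite [X in _ + X]big1 ?addr0 // => k /negPf ki.
by rewrite big1 // => l _; rewrite !mxE inord_val ki mul0r scale0r.
Qed.

(* Main.v *)
Require Import Defs.
From HB Require Import structures.
From mathcomp Require Import all_boot all_order all_algebra.

Set Implicit Arguments.
Unset Strict Implicit.
Unset Printing Implicit Defensive.

Import GRing.Theory.
Local Open Scope ring_scope.

(** Every half-derivation of W_2 is a scalar multiple of the identity, and a
    linear map that multiplies each vector by a scalar depending on the vector
    is a homothety; so a local half-derivation is a homothety, and homotheties
    are half-derivations of any algebra.

    That half-derivations d are scalar (W2_half_derivation_scalar) is seen by
    comparing integer eigenvalues.  The product e e = - e for e = xi_1 makes d e
    an eigenvector of (left + right multiplication by e) for the eigenvalue -2,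
    whose eigenspace is the line of e; subtract the scalar so that d e = 0.
    The kernel of a half-derivation is closed under products, and for x in this
    kernel, d sends the m-eigenspace of the left multiplication by x into its
    2m-eigenspace (left_eigen_half_derivation).  Left multiplication by xi_1 has
    the eigenvalues 1 at xi_3 and -2 at xi_4, but neither 2 nor -4, so xi_3 and
    xi_4 are killed.  Products then kill xi_6 - xi_2 = xi_4 xi_3 and
    2 (xi_1 - xi_5) = xi_4 (xi_6 - xi_2), hence xi_5.  Finally d xi_2 is killed
    on the left by xi_1 and is a (-2)-eigenvector for xi_5; the first condition
    confines it to the span of xi_2 and xi_6, on which xi_5 acts by -1. *)

(** * Homotheties and half-derivations of an arbitrary algebra *)

Section Generic.
Variables (K : fieldType) (A : lmodType K) (mul : A -> A -> A).
Hypotheses (mulDl : forall y, linear (mul^~ y)).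
Hypotheses (mulDr : forall x, linear (mul x)).

Let mulZl a x y : mul (a *: x) y = a *: mul x y.
Proof. exact: (scalable_linear (mulDl y)). Qed.

Let mulZr a x y : mul x (a *: y) = a *: mul x y.
Proof. exact: (scalable_linear (mulDr x)). Qed.

Let mulBl x y z : mul (x - y) z = mul x z - mul y z.
Proof. by rewrite addrC -scaleN1r (mulDl z) scaleN1r addrC. Qed.

Let mulBr x y z : mul x (y - z) = mul x y - mul x z.
Proof. by rewrite addrC -scaleN1r (mulDr x) scaleN1r addrC. Qed.

Let mul0l y : mul 0 y = 0.
Proof. by rewrite -[X in mul X _](scale0r 0) mulZl scale0r. Qed.

Let mul0r x : mul x 0 = 0.
Proof. by rewrite -[X in mul _ X](scale0r 0) mulZr scale0r. Qed.

Lemma half_derivation_homothety (c : K) (d : {linear A -> A}) :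
  (2%:R : K) != 0 -> (forall x, d x = c *: x) -> half_derivation mul d.
Proof.
move=> nz2 dE x y; rewrite !dE mulZl mulZr -mulr2n -scaler_nat !scalerA.
by rewrite mulKf.
Qed.

Lemma half_derivation_sub (d e : {linear A -> A}) :
  half_derivation mul d -> half_derivation mul e ->
  half_derivation mul (d \- e).
Proof.
move=> dP eP x y; rewrite /= dP eP -scalerBr mulBl mulBr.
by rewrite opprD addrACA.
Qed.

Variable d : {linear A -> A}.
Hypotheses (nz2 : (2%:R : K) != 0) (dP : half_derivation mul d).

Lemma half_derivation_double x y : 2%:R *: d (mul x y) = mul (d x) y + mul x (d y).
Proof. by rewrite dP scalerA mulfV ?scale1r. Qed.

Lemma half_derivation_ker_mul x y : d x = 0 -> d y = 0 -> d (mul x y) = 0.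
Proof.
by move=> dx dy; rewrite dP dx dy mul0l mul0r addr0 scaler0.
Qed.

(** For d x = 0 the identity 2 d (x y) = (d x) y + x (d y) loses a term, which
    makes d double the eigenvalues of the left multiplication by x. *)
Lemma left_eigen_half_derivation x y (m : int) :
  d x = 0 -> mul x y = m%:~R *: y -> mul x (d y) = (m * 2)%:~R *: d y.
Proof.
move=> dx xy; have := half_derivation_double x y.
rewrite dx mul0l add0r => <-.
by rewrite xy linearZ scalerA intrM mulrC.
Qed.

End Generic.

Lemma intr_inj_pchar0 (K : fieldType) :
  [pchar K] =i pred0 -> injective (intr : int -> K).
Proof.
move/pcharf0P => charP.
have nat0 (n : nat) : n%:R = 0 :> K -> n = 0%N by move/eqP; rewrite charP => /eqP.
move=> m n /eqP; rewrite -subr_eq0 -intrB => /eqP mn0.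
apply/eqP; rewrite -subr_eq0; case: (m - n) mn0 => p; first by move/nat0->.
by rewrite NegzE mulrNz => /eqP; rewrite oppr_eq0 => /eqP/nat0.
Qed.

(** Comparing the scalar of the all-ones vector with that of each basis vector
    forces them all to agree. *)
Lemma pointwise_homothety (K : fieldType) n (D : {linear 'rV[K]_n -> 'rV[K]_n}) :
  (forall x, exists c : K, D x = c *: x) -> exists c : K, forall x, D x = c *: x.
Proof.
move=> DP; have [c Dc] := DP (const_mx 1); exists c.
have Ddelta i : D (delta_mx 0 i) = c *: delta_mx 0 i.
  have [a Da] := DP (delta_mx 0 i); rewrite Da; congr (_ *: _).
  move/rowP/(_ i): Dc; rewrite {1}(row_sum_delta (const_mx 1)) linear_sum summxE.
  rewrite (bigD1 i) //= big1 => [|j ji]; rewrite !mxE linearZ /=.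
    by rewrite scale1r addr0 mulr1 Da !mxE !eqxx mulr1.
  have [b ->] := DP (delta_mx 0 j).
  by rewrite !mxE (eq_sym i) (negPf ji) andbF !mulr0.
move=> x; rewrite (row_sum_delta x) linear_sum scaler_sumr.
by apply: eq_bigr => i _; rewrite linearZ /= Ddelta !scalerA mulrC.
Qed.

(** * Diagonal multiplication operators of W_2 *)

Section W2.
Variable K : fieldType.

Notation "x '*w' y" := (@W2_mul K x y) (at level 40).
Notation "''xi_' k" := (xi K k) (at level 8, k at level 2, format "''xi_' k").

Lemma xiE (k : nat) (i : 'I_6) : (k < 6)%N -> 'xi_k.+1 0 i = (i == k :> nat)%:R.
Proof. by move=> k6; rewrite mxE eqxx /= -val_eqE /= inordK. Qed.

Lemma rV6_xi (v : 'rV[K]_6) : v = \sum_(i < 6) v 0 i *: 'xi_i.+1.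
Proof. by rewrite {1}[v]row_sum_delta; apply: eq_bigr => i _; rewrite /xi inord_val. Qed.

Lemma xi_mul (i j : nat) : (i < 6)%N -> (j < 6)%N ->
  'xi_i.+1 *w 'xi_j.+1 = W2_table K i.+1 j.+1.
Proof. by move=> i6 j6; rewrite (W2_mul_xi K (Ordinal i6) (Ordinal j6)). Qed.

Lemma xi_mull (i : nat) v : (i < 6)%N ->
  'xi_i.+1 *w v = \sum_(j < 6) v 0 j *: W2_table K i.+1 j.+1.
Proof.
move=> i6; pose f : {linear _ -> _} := HB.pack (W2_mul 'xi_i.+1)
  (GRing.isLinear.Build _ _ _ _ _ (W2_mul_linearr 'xi_i.+1)).
rewrite -[LHS]/(f v) {1}[v]rV6_xi linear_sum; apply: eq_bigr => j _.
by rewrite linearZ /= xi_mul.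
Qed.

Lemma xi_mulr (j : nat) v : (j < 6)%N ->
  v *w 'xi_j.+1 = \sum_(i < 6) v 0 i *: W2_table K i.+1 j.+1.
Proof.
move=> j6; pose f : {linear _ -> _} := HB.pack ((@W2_mul K)^~ 'xi_j.+1)
  (GRing.isLinear.Build _ _ _ _ _ (W2_mul_linearl 'xi_j.+1)).
rewrite -[LHS]/(f v) {1}[v]rV6_xi linear_sum; apply: eq_bigr => i _.
by rewrite linearZ /= xi_mul.
Qed.

(** The multiplications below are diagonal in the basis xi with integer
    weights w; recording the weights as integers turns each comparison of
    eigenvalues in characteristic zero into a computation. *)
Lemma diagonal_sum (T : nat -> 'rV[K]_6) (w : seq int) (v : 'rV[K]_6) k :
  (forall j : 'I_6, T j = (w`_j)%:~R *: 'xi_j.+1) ->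
  (\sum_(j < 6) v 0 j *: T j) 0 k = (w`_k)%:~R * v 0 k.
Proof.
move=> TE; rewrite summxE (bigD1 k) //= big1 => [|j /negPf jk].
  by rewrite TE !mxE inord_val !eqxx mulr1 addr0 mulrC.
by rewrite TE !mxE inord_val (eq_sym k) jk !mulr0.
Qed.

Local Ltac table_cases :=
  case=> [[|[|[|[|[|[|//]]]]]] ?];
  by rewrite /= ?mulrNz ?scaleNr ?scale0r ?scale1r.

Lemma xi1_mul v k : ('xi_1 *w v) 0 k = ([:: -1; 0; 1; -2; -1; 0 : int]`_k)%:~R * v 0 k.
Proof.
rewrite xi_mull //; apply: (diagonal_sum (T := fun j => W2_table K 1 j.+1)).
by table_cases.
Qed.

Lemma mul_xi1 v k : (v *w 'xi_1) 0 k = ([:: -1; -1; 0; 1; 0; 0 : int]`_k)%:~R * v 0 k.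
Proof.
rewrite xi_mulr //; apply: (diagonal_sum (T := fun i => W2_table K i.+1 1)).
by table_cases.
Qed.

Lemma xi5_mul v k : ('xi_5 *w v) 0 k = ([:: 0; -1; -2; 1; 0; -1 : int]`_k)%:~R * v 0 k.
Proof.
rewrite xi_mull //; apply: (diagonal_sum (T := fun j => W2_table K 5 j.+1)).
by table_cases.
Qed.

(** * Half-derivations of W_2 *)

Hypothesis charK0 : [pchar K] =i pred0.

Lemma eigen_coord_eq0 (x v : 'rV[K]_6) (w : seq int) (m : int) (k : 'I_6) :
  (forall u k, (x *w u) 0 k = (w`_k)%:~R * u 0 k) ->
  x *w v = m%:~R *: v -> w`_k != m -> v 0 k = 0.
Proof.
move=> xE /rowP/(_ k); rewrite xE mxE => /eqP.
rewrite -subr_eq0 -mulrBl mulf_eq0 subr_eq0.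
by case/orP => [/eqP/(intr_inj_pchar0 charK0)-> /eqP // | /eqP].
Qed.

Lemma eigen_eq0 (x v : 'rV[K]_6) (w : seq int) (m : int) :
  (forall u k, (x *w u) 0 k = (w`_k)%:~R * u 0 k) ->
  x *w v = m%:~R *: v -> (forall k : 'I_6, w`_k != m) -> v = 0.
Proof.
move=> xE xv wm; apply/rowP => k.
by rewrite (eigen_coord_eq0 xE xv (wm k)) mxE.
Qed.

Let nz2 : (2%:R : K) != 0.
Proof. by have /pcharf0P -> := charK0. Qed.

(** As xi_1 xi_1 = - xi_1, the sum of the left and right multiplications by xi_1
    maps d xi_1 to -2 d xi_1; its weights are -2, -1, 1, -1, -1, 0. *)
Lemma half_derivation_xi1 (d : {linear 'rV[K]_6 -> 'rV[K]_6}) :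
  half_derivation (@W2_mul K) d -> d 'xi_1 = d 'xi_1 0 0 *: 'xi_1.
Proof.
move=> dP; apply/rowP => k; rewrite mxE xiE //.
have /rowP/(_ k) := half_derivation_double nz2 dP 'xi_1 'xi_1.
rewrite xi_mul //= linearN !mxE xi1_mul mul_xi1 -mulrDl -intrD => /eqP.
rewrite mulrN -mulNr -(intrN K 2) -subr_eq0 -mulrBl -intrB mulf_eq0.
have [->|k0 /orP[/eqP kw|/eqP->]] := eqVneq k 0; first by rewrite mulr1.
  have /eqP := @intr_inj_pchar0 _ charK0 _ 0 kw.
  by case: k k0 {kw} => [[|[|[|[|[|[|//]]]]]] ?].
by rewrite -[k == _ :> nat]/(k == 0) (negPf k0) mulr0.
Qed.

(** The kernel of d is a subalgebra, and xi_1 in it drags every other basis vector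
    along, by doubling of eigenvalues or as part of a product. *)
Lemma half_derivation_eq0 (d : {linear 'rV[K]_6 -> 'rV[K]_6}) :
  half_derivation (@W2_mul K) d -> d 'xi_1 = 0 -> forall v, d v = 0.
Proof.
move=> dP d1.
have double := left_eigen_half_derivation (@W2_mul_linearl K) nz2 dP.
have kerM := half_derivation_ker_mul (@W2_mul_linearl K) (@W2_mul_linearr K) dP.
have d3 : d 'xi_3 = 0.
  apply: (eigen_eq0 xi1_mul (double _ _ 1 d1 _)).
    by rewrite xi_mul // scale1r.
  by case=> [[|[|[|[|[|[|//]]]]]] ?].
have d4 : d 'xi_4 = 0.
  apply: (eigen_eq0 xi1_mul (double _ _ (-2) d1 _)).
    by rewrite xi_mul //= mulrNz scaleNr.
  by case=> [[|[|[|[|[|[|//]]]]]] ?].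
(* xi_6 - xi_2 = xi_4 xi_3 *)
have d62 : d ('xi_6 - 'xi_2) = 0.
  by have := kerM _ _ d4 d3; rewrite xi_mul //= addrC.
have d5 : d 'xi_5 = 0.
  (* xi_4 (xi_6 - xi_2) = 2 (xi_1 - xi_5) *)
  have := kerM _ _ d4 d62.
  rewrite addrC -scaleN1r W2_mul_linearr !xi_mul //= scaleN1r.
  rewrite linearB linearN linearB linearZ /= d1 scaler0 subr0 -opprD => /eqP.
  by rewrite oppr_eq0 -mulr2n -scaler_nat scaler_eq0 (negPf nz2) => /eqP.
have d2 : d 'xi_2 = 0.
  apply/rowP => k; rewrite [RHS]mxE.
  (* The coordinates on xi_2 and xi_6 vanish by the action of xi_5, the others
     by that of xi_1. *)
  have [k26|k26] := boolP (k \in [:: 1; 5]).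
    apply: (eigen_coord_eq0 xi5_mul (double _ _ (-1) d5 _)).
      by rewrite xi_mul //= scaleN1r.
    by move: k26; rewrite !inE => /orP[]/eqP->.
  apply: (eigen_coord_eq0 xi1_mul (double _ _ 0 d1 _)).
    by rewrite xi_mul //= scale0r.
  by case: k k26 => [[|[|[|[|[|[|//]]]]]] ?].
have d6 : d 'xi_6 = 0 by move: d62; rewrite linearB /= d2 subr0.
move=> v; rewrite [v]rV6_xi linear_sum big1 // => j _; rewrite linearZ /=.
have -> : d 'xi_j.+1 = 0 by case: j => [[|[|[|[|[|[|//]]]]]] ?].
by rewrite scaler0.
Qed.

Lemma W2_half_derivation_scalar (d : {linear 'rV[K]_6 -> 'rV[K]_6}) :
  half_derivation (@W2_mul K) d -> exists c, forall v, d v = c *: v.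
Proof.
move=> dP; exists (d 'xi_1 0 0) => v; apply/eqP; rewrite -subr_eq0; apply/eqP.
set c := d 'xi_1 0 0.
apply: (half_derivation_eq0 (d := d \- c \*: idfun)) => /=.
  apply: (half_derivation_sub (@W2_mul_linearl K) (@W2_mul_linearr K) dP).
  by apply: (half_derivation_homothety (c := c) (@W2_mul_linearl K) (@W2_mul_linearr K)).
by rewrite (half_derivation_xi1 dP) subrr.
Qed.

End W2.

Theorem theorem2p2 (K : fieldType) (charK0 : [pchar K] =i pred0)
    (D : {linear 'rV[K]_6 -> 'rV[K]_6}) :
  local_half_derivation (@W2_mul K) D -> half_derivation (@W2_mul K) D.
Proof.
have nz2 : (2%:R : K) != 0 by have /pcharf0P -> := charK0.
move=> DP; have [|c Dc] := @pointwise_homothety K 6 D.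
  move=> x; have [d dP ->] := DP x.
  by have [c dE] := W2_half_derivation_scalar charK0 dP; exists c.
exact: (half_derivation_homothety (@W2_mul_linearl K) (@W2_mul_linearr K) nz2 Dc).
Qed.
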